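(* The following are equivalent for a Banach space $X$: (1) $X$ Lipschitzly embeds into $\ell_\infty$. (2) There is a coarse map $f\colon X\to\ell_\infty$ which is linearly expanding at rate $\alpha$, for some $\alpha\in(0,1)$.
   Context: $X$ Lipschitzly embeds into $Y$ if there is a (not necessarily linear) map $F\colon X\to Y$ and a constant $D\ge 1$ with $\frac1D\|x-z\|\le\|F(x)-F(z)\|\le D\|x-z\|$ for all $x,z\in X$. A map $f\colon X\to Y$ between Banach spaces is coarse if $\omega_f(t)=\sup\{\|f(x)-f(z)\| : \|x-z\|\le t\}<\infty$ for all $t\ge 0$. For $\alpha\in[0,1]$, a map $f\colon X\to Y$ between Banach spaces is linearly expanding at rate $\alpha$ if for every $L>0$ there is $C>0$ such that, for all $x,z\in X$, $\|x-z\|\ge L\max\{\|x\|^\alpha,\|z\|^\alpha\}+L$ implies $\|f(x)-f(z)\|\ge\frac1C\|x-z\|-C$. *)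

(* Defs.v *)
From HB Require Import structures.
From mathcomp Require Import all_boot all_order all_algebra.
From mathcomp Require Import all_classical all_reals all_analysis.

Set Implicit Arguments.
Unset Strict Implicit.
Unset Printing Implicit Defensive.

Import Order.TTheory GRing.Theory Num.Theory.
Import numFieldNormedType.Exports.

Local Open Scope classical_set_scope.
Local Open Scope ring_scope.

Section linfty_space.
Variable R : realType.

(* R^o is R as a normed module over itself, so that nat -> R^o carries the
   pointwise vector space structure. *)
Definition bounded_seq : {pred nat -> R^o} :=
  [pred u : nat -> R^o | `[< bounded_fun u >]].

Lemma bounded_seqP (u : nat -> R^o) :
  reflect (exists M, forall n, `|u n| <= M) (u \in bounded_seq).
Proof.
have PF : ProperFilter (globally [set: nat]).
  exact: (globally_properfilter (a := 0%N)).
apply: (iffP (asboolP _)) => [/ex_bound[M uM]|[M uM]].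
  by exists M => n; exact: uM.
by apply/ex_bound; exists M => n _; exact: uM.
Qed.

Fact bounded_seq_submod_closed : submod_closed bounded_seq.
Proof.
split; first by apply/bounded_seqP; exists 0 => n; rewrite normr0.
move=> a u v /bounded_seqP[M uM] /bounded_seqP[N vN].
apply/bounded_seqP; exists (`|a| * M + N) => n.
rewrite (le_trans (ler_normD _ _))// lerD//.
by rewrite [X in X <= _]normrM ler_wpM2l.
Qed.

HB.instance Definition _ :=
  GRing.isSubmodClosed.Build R (nat -> R^o) bounded_seq
    bounded_seq_submod_closed.

Record linfty := Linfty {
  linfty_val :> nat -> R^o ;
  linfty_valP : linfty_val \in bounded_seq }.

HB.instance Definition _ := [isSub of linfty for linfty_val].
HB.instance Definition _ := [Choice of linfty by <:].
HB.instance Definition _ := [SubChoice_isSubLmodule of linfty by <:].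

Definition linfty_norm (u : linfty) : R := sup (range (fun n => `|u n|)).

Lemma linfty_norm_ge (u : linfty) n : `|u n| <= linfty_norm u.
Proof.
have /bounded_seqP[M uM] := linfty_valP u.
by apply: ub_le_sup; [exists M => _ [m _ <-]; exact: uM|exists n].
Qed.

Lemma linfty_norm_le (u : linfty) M :
  (forall n, `|u n| <= M) -> linfty_norm u <= M.
Proof.
by move=> uM; apply: ge_sup; [exists `|u 0%N|, 0%N|move=> _ [n _ <-]].
Qed.

Fact linfty_normD (u v : linfty) :
  linfty_norm (u + v) <= linfty_norm u + linfty_norm v.
Proof.
apply: linfty_norm_le => n.
by rewrite (le_trans (ler_normD _ _))// lerD// linfty_norm_ge.
Qed.

Fact linfty_normZ (a : R) (u : linfty) :
  linfty_norm (a *: u) = `|a| * linfty_norm u.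
Proof.
have E n : `|(a *: u : linfty) n| = `|a| * `|u n| by exact: normrM.
apply/eqP; rewrite eq_le; apply/andP; split.
  by apply: linfty_norm_le => n; rewrite E ler_wpM2l// linfty_norm_ge.
have [->|a0] := eqVneq a 0.
  rewrite normr0 mul0r; apply: le_trans (linfty_norm_ge _ 0%N).
  exact: normr_ge0.
rewrite -ler_pdivlMl ?normr_gt0//; apply: linfty_norm_le => n.
by rewrite ler_pdivlMl ?normr_gt0// -E linfty_norm_ge.
Qed.

Fact linfty_norm0_eq0 (u : linfty) : linfty_norm u = 0 -> u = 0.
Proof.
move=> u0; apply/val_inj/funext => n.
by apply/eqP; rewrite -normr_le0 -u0; exact: linfty_norm_ge.
Qed.

HB.instance Definition _ := Lmodule_isNormed.Build R linfty
  linfty_normD linfty_normZ linfty_norm0_eq0.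

Fact linfty_complete (F : set_system linfty) :
  ProperFilter F -> cauchy F -> cvg F.
Proof.
move=> FF /cauchy_ballP Fc.
have ball_norm (e : R) (u v : linfty) : ball u e v -> linfty_norm (u - v) < e.
  by rewrite -ball_normE.
have coordB (u v : linfty) n : (u - v : linfty) n = u n - v n by [].
have coord_cvg n : cvg ((fun u : linfty => u n) @ F).
  apply/cauchy_cvgP/cauchy_ballP => e e0.
  have [[A B] /= [FA FB] AB] := Fc e e0.
  exists ((fun u : linfty => u n) @` A, (fun u : linfty => u n) @` B) => /=.
    by split; [apply: filterS FA|apply: filterS FB] => u ?; exists u.
  move=> [_ _] /= [[u Au <-] [v Bv <-]].
  have /ball_norm := AB (u, v) (conj Au Bv); apply: le_lt_trans => /=.
  by rewrite -coordB; exact: linfty_norm_ge.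
pose l : nat -> R^o := fun n => lim ((fun u : linfty => u n) @ F).
have close (e : R) : 0 < e -> F [set u : linfty | forall n, `|l n - u n| <= e].
  move=> e0; have [[A B] /= [FA FB] AB] := Fc e e0.
  near=> u; move=> n; have Au : A u by near: u.
  have dist : (fun v : linfty => `|v n - u n|) @ F --> `|l n - u n|.
    by apply: cvg_norm; apply: cvgB; [exact: coord_cvg|exact: cvg_cst].
  rewrite -(cvg_lim _ dist)//.
  apply: limr_le; first by apply/cvg_ex; eexists; exact: dist.
  near=> v; have Bv : B v by near: v.
  rewrite distrC -coordB (le_trans (linfty_norm_ge _ _))//.
  exact/ltW/ball_norm/(AB (u, v)).
have lB : l \in bounded_seq.
  have [u ul] := filter_ex (close 1 ltr01).
  have /bounded_seqP[M uM] := linfty_valP u.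
  apply/bounded_seqP; exists (1 + M) => n.
  by rewrite -(subrK (u n) (l n)) (le_trans (ler_normD _ _))// lerD.
apply/cvg_ex; exists (Linfty lB); apply/cvgrPdist_le => e e0.
near=> u; apply: linfty_norm_le => n.
by rewrite coordB /=; move: n; near: u; exact: close.
Unshelve. all: by end_near. Qed.

HB.instance Definition _ := Uniform_isComplete.Build linfty linfty_complete.

End linfty_space.

Section nonlinear_maps.
Variables (R : realType) (X Y : completeNormedModType R).

Definition lipschitzly_embeds : Prop :=
  exists (F : X -> Y) (D : R), 1 <= D /\
    forall x z, D^-1 * `|x - z| <= `|F x - F z| <= D * `|x - z|.

Definition expansion_modulus (f : X -> Y) (t : R) : \bar R :=
  ereal_sup
    [set (`|f p.1 - f p.2|)%:E | p in [set p : X * X | `|p.1 - p.2| <= t]].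

Definition coarse (f : X -> Y) : Prop :=
  forall t : R, 0 <= t -> (expansion_modulus f t < +oo)%E.

(* The notion is meant for 0 <= alpha <= 1; for alpha = 0, 0 `^ 0 = 1. *)
Definition linearly_expanding (alpha : R) (f : X -> Y) : Prop :=
  forall L : R, 0 < L -> exists2 C : R, 0 < C &
    forall x z : X,
      L * Num.max (`|x| `^ alpha) (`|z| `^ alpha) + L <= `|x - z| ->
      C^-1 * `|x - z| - C <= `|f x - f z|.

End nonlinear_maps.

(* Main.v *)
Require Import Defs.
From mathcomp Require Import all_boot all_order all_algebra.
From mathcomp Require Import all_classical all_reals all_analysis.
From mathcomp Require Import ring lra.

(** A coarse map [f] satisfies [|f x - f z| <= K |x - z| + K], so replacing each
    coordinate of [f] by its infimal convolution with [K |.|] gives a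
    [K]-Lipschitz map [g] at distance at most [K] from [f]. The rescalings
    [(g (n x) - g 0) / n], n >= 1, are uniformly Lipschitz and their coordinates
    together form one map into [l_oo]. As [alpha < 1], any two points
    [x <> z] eventually satisfy [|n x - n z| >= max(|n x|^alpha, |n z|^alpha) + 1],
    so linear expansion bounds the distance of the images below by
    [|x - z| / C - O(1/n)] for all large n, hence by [|x - z| / C]. *)

Import Order.TTheory GRing.Theory Num.Theory.
Import numFieldNormedType.Exports.
Local Open Scope ring_scope.

Lemma lipschitzly_embeds_coarse {R : realType} {X Y : completeNormedModType R}
    {F : X -> Y} {D : R} : 0 <= D ->
  (forall x z, `|F x - F z| <= D * `|x - z|) -> coarse F.
Proof.
move=> D0 FD t t0; apply: (@le_lt_trans _ _ (D * t)%:E); last exact: ltry.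
apply: ge_ereal_sup => _ [[x z] /= xz <-].
by rewrite lee_fin (le_trans (FD x z))// ler_wpM2l.
Qed.

(** The segment from [z] to [x] is cut into pieces of length at most 1, and the image moves by at
    most [K], the modulus at 1, along each. *)
Lemma coarse_large_scale_lipschitz {R : realType} {X Y : completeNormedModType R}
    {f : X -> Y} : coarse f ->
  exists2 K, 0 <= K & forall x z, `|f x - f z| <= K * `|x - z| + K.
Proof.
move=> /(_ 1 ler01) fc.
have ub x z : `|x - z| <= 1 -> ((`|f x - f z|)%:E <= expansion_modulus f 1)%E.
  by move=> xz; apply: ereal_sup_ubound; exists (x, z).
(* The pair [(0, 0)] makes the modulus nonnegative, which excludes [-oo] and gives [0 <= K]. *)
have := ub 0 0; rewrite !subrr !normr0 => /(_ ler01).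
case: (expansion_modulus f 1) fc ub => // K _ ub; rewrite lee_fin => K0.
exists K => // x z.
have chain n : forall y, `|y - z| <= n%:R -> `|f y - f z| <= n%:R * K.
  elim: n => [|n IH] y.
    by rewrite normr_le0 subr_eq0 => /eqP ->; rewrite subrr normr0 mul0r.
  move=> yz; pose w := z + (n%:R / n.+1%:R : R) *: (y - z).
  have n1 : 0 < n.+1%:R :> R by [].
  have yw : `|y - w| <= 1.
    have -> : y - w = n.+1%:R^-1 *: (y - z).
      rewrite /w opprD addrA -{1}[y - z]scale1r -scalerBl.
      by congr (_ *: _); rewrite -natr1; field; rewrite natr1 gt_eqF.
    by rewrite normrZ gtr0_norm ?invr_gt0// ler_pdivrMl// mulr1.
  have wz : `|w - z| <= n%:R.
    rewrite /w addrC addKr normrZ ger0_norm ?divr_ge0//.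
    by rewrite -mulrA ler_piMr// ler_pdivrMl// mulr1.
  rewrite -(subrKA (f w)) (le_trans (ler_normD _ _))//.
  rewrite -natr1 mulrDl mul1r addrC lerD ?IH//.
  by rewrite -lee_fin ub.
have /chain/le_trans -> // : `|x - z| <= (Num.truncn `|x - z|).+1%:R.
  by rewrite ltW// truncnS_gt.
rewrite -natr1 mulrDl mul1r mulrC lerD2r ler_wpM2l//.
by rewrite truncn_le.
Qed.

Section infimal_convolution.
Context {R : realType} {X : normedModType R}.
Variables (K : R) (f : X -> R).
Hypothesis K0 : 0 <= K.
Hypothesis fK : forall x z, `|f x - f z| <= K * `|x - z| + K.

(** The Pasch-Hausdorff envelope: the largest [K]-Lipschitz function below [f]. *)
Definition infconv (x : X) : R := inf (range (fun y => f y + K * `|x - y|)).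

Lemma infconv_le x y : infconv x <= f y + K * `|x - y|.
Proof.
apply: ge_inf; last by exists y.
(* A real [inf] is meaningful only with a lower bound; [fK] supplies this one. *)
exists (f x - K) => _ [w _ <-].
by have := ler_normlW (fK x w); lra.
Qed.

Lemma le_infconv x c : (forall y, c <= f y + K * `|x - y|) -> c <= infconv x.
Proof.
move=> cf; apply: lb_le_inf; first by exists (f x + K * `|x - x|), x.
by move=> _ [y _ <-].
Qed.

Lemma infconv_lipschitz x z : `|infconv x - infconv z| <= K * `|x - z|.
Proof.
have half a b : infconv a - infconv b <= K * `|a - b|.
  rewrite lerBlDl -lerBlDr; apply: le_infconv => y.
  rewrite lerBlDr (le_trans (infconv_le a y))// -addrA lerD2l -mulrDr.
  by rewrite ler_wpM2l// [leRHS]addrC ler_distD.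
by rewrite ler_norml half andbT lerNl opprB distrC half.
Qed.

Lemma infconv_near x : f x - K <= infconv x <= f x.
Proof.
apply/andP; split.
  by apply: le_infconv => y; have := ler_normlW (fK x y); lra.
by have := infconv_le x x; rewrite subrr normr0 mulr0 addr0.
Qed.

(** Both values are lowered by an amount in [[0, K]], so their difference changes by at most [K],
    not [2K]. *)
Lemma infconv_expanding x z : `|f x - f z| - K <= `|infconv x - infconv z|.
Proof.
have /andP[x1 x2] := infconv_near x; have /andP[z1 z2] := infconv_near z.
rewrite lerBlDr ler_norml; apply/andP; split.
  by have := lerNnormlW (lexx `|infconv x - infconv z|); lra.
by have := ler_norm (infconv x - infconv z); lra.
Qed.

End infimal_convolution.

Section rescaling.
Context {R : realType} {X : normedModType R}.
Variables (K : R) (g : nat -> X -> R).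
Hypothesis gK : forall k x z, `|g k x - g k z| <= K * `|x - z|.

(** Subtracting [g k 0] makes every rescaling vanish at 0, so the Lipschitz estimate bounds all of
    them at [x] uniformly in [n] and [k]. *)
Definition rescale (n k : nat) (x : X) : R :=
  n.+1%:R^-1 * (g k (n.+1%:R *: x) - g k 0).

Lemma rescaleB n k x z : `|rescale n k x - rescale n k z| =
  n.+1%:R^-1 * `|g k (n.+1%:R *: x) - g k (n.+1%:R *: z)|.
Proof.
rewrite /rescale -mulrBr normrM gtr0_norm ?invr_gt0//.
by congr (_ * `|_|); ring.
Qed.

Lemma rescale_lipschitz n k x z :
  `|rescale n k x - rescale n k z| <= K * `|x - z|.
Proof.
rewrite rescaleB ler_pdivrMl// (le_trans (gK _ _ _))//.
by rewrite -scalerBr normrZ gtr0_norm// mulrCA.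
Qed.

(** Pairs [(n, k)] are coded as single indices; the default pair makes indices that code nothing
    repeat a rescaling, so every estimate still holds there. *)
Definition rescale_seq (x : X) (m : nat) : R^o :=
  let p := odflt (0%N, 0%N) (unpickle m) in rescale p.1 p.2 x.

Lemma rescale_seq_bounded x : rescale_seq x \in @bounded_seq R.
Proof.
apply/bounded_seqP; exists (K * `|x|) => m; rewrite /rescale_seq.
case: (odflt _ _) => n k /=; have := rescale_lipschitz n k x 0.
by rewrite subr0 {2}/rescale scaler0 subrr mulr0 subr0.
Qed.

Definition rescale_map (x : X) : linfty R := Linfty (rescale_seq_bounded x).

Lemma rescale_map_lipschitz x z :
  `|rescale_map x - rescale_map z| <= K * `|x - z|.
Proof. by apply: linfty_norm_le => m; exact: rescale_lipschitz. Qed.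

Lemma rescale_map_ge n k x z :
  n.+1%:R^-1 * `|g k (n.+1%:R *: x) - g k (n.+1%:R *: z)| <=
  `|rescale_map x - rescale_map z|.
Proof.
rewrite -rescaleB.
have := linfty_norm_ge (rescale_map x - rescale_map z) (pickle (n, k)).
have -> : (rescale_map x - rescale_map z) (pickle (n, k)) =
    rescale_seq x (pickle (n, k)) - rescale_seq z (pickle (n, k)) by [].
by rewrite /rescale_seq pickleK.
Qed.

End rescaling.

Lemma powR_sublinear {R : realType} (alpha B d : R) :
    alpha < 1 -> 0 <= B -> 0 < d ->
  exists N : R, forall t, N <= t -> t `^ alpha * B + 1 <= t * d.
Proof.
move=> a1 B0 d0; pose b := 1 - alpha; have b0 : 0 < b by rewrite subr_gt0.
pose q := 2 * B / d; have q0 : 0 <= q by rewrite !mulr_ge0// invr_ge0 ltW.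
have d2 : 0 < 2 / d by rewrite divr_gt0.
(* The first threshold gives [t^alpha B <= t d / 2], the second [1 <= t d / 2]. *)
exists (Num.max (q `^ b^-1) (2 / d)) => t; rewrite ge_max => /andP[qt dt].
have t0 : 0 < t by exact: lt_le_trans dt.
have {qt} : q <= t `^ b.
  have -> : q = (q `^ b^-1) `^ b by rewrite -powRrM mulVf ?gt_eqF// powRr1.
  by rewrite ge0_ler_powR// ?nnegrE ?powR_ge0// ltW.
move=> /(ler_wpM2l (powR_ge0 t alpha)).
rewrite -powRD; last by rewrite (gt_eqF t0) implybT.
rewrite /b addrC subrK powRr1 ?(ltW t0)// /q mulrA ler_pdivrMr//.
move: dt; rewrite ler_pdivrMr//; lra.
Qed.

(** Under dilation by [t] the required separation grows like [t^alpha] and the distance like [t].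
    Only [N] depends on the pair: [C] comes from [L = 1] and is uniform. *)
Lemma linearly_expanding_dilation {R : realType} {X Y : completeNormedModType R}
    {alpha : R} {f : X -> Y} : alpha < 1 -> linearly_expanding alpha f ->
  exists2 C : R, 0 < C & forall x z, x != z -> exists N : R,
    forall t, N <= t -> 0 < t ->
      C^-1 * (t * `|x - z|) - C <= `|f (t *: x) - f (t *: z)|.
Proof.
move=> a1 /(_ 1 ltr01)[C C0 fC]; exists C => // x z xz.
have d0 : 0 < `|x - z| by rewrite normr_gt0 subr_eq0.
have [|N tN] := @powR_sublinear _ alpha
  (Num.max (`|x| `^ alpha) (`|z| `^ alpha)) `|x - z| a1 _ d0.
  by rewrite le_max powR_ge0.
exists N => t Nt t0; have := fC (t *: x) (t *: z).
rewrite -scalerBr !normrZ (gtr0_norm t0) mul1r !powRM ?(ltW t0)//; apply.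
by rewrite -maxr_pMr ?powR_ge0// tN.
Qed.

Theorem theorem1p9 (R : realType) (X : completeNormedModType R) :
  lipschitzly_embeds X (linfty R) <->
  (exists (alpha : R) (f : X -> linfty R),
     0 < alpha < 1 /\ coarse f /\ linearly_expanding alpha f).
Proof.
split.
  move=> [F [D [D1 FD]]]; have D0 : 0 < D by exact: lt_le_trans D1.
  (* Any rate would do, since the lower bound for [F] holds at all pairs. *)
  exists 2^-1, F; split; first by lra.
  split.
    apply: (lipschitzly_embeds_coarse (ltW D0)) => x z.
    by have /andP[] := FD x z.
  move=> L _; exists D => // x z _.
  by have /andP[+ _] := FD x z; lra.
move=> [alpha [f [/andP[_ a1] [/coarse_large_scale_lipschitz[K K0 fK]]]]].
move=> /(linearly_expanding_dilation a1)[C C0 fC].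
have coordK k x z : `|f x k - f z k| <= K * `|x - z| + K.
  exact: le_trans (linfty_norm_ge (f x - f z) k) (fK x z).
pose g k := infconv K (fun x => f x k).
have gK k x z : `|g k x - g k z| <= K * `|x - z| by exact: infconv_lipschitz.
pose D := Num.max 1 (Num.max K C).
have [D1 KD CD] : [/\ 1 <= D, K <= D & C <= D].
  by rewrite /D !le_max !lexx !orbT.
exists (rescale_map K g gK), D; split=> // x z; apply/andP; split; last first.
  by rewrite (le_trans (rescale_map_lipschitz _ _ _ _ _))// ler_wpM2r.
have [->|xz] := eqVneq x z; first by rewrite !subrr !normr0 mulr0.
apply: (@le_trans _ _ (C^-1 * `|x - z|)).
  by rewrite ler_wpM2r// lef_pV2// posrE (lt_le_trans _ CD).
have [N fN] := fC x z xz.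
apply/ler_addgt0Pr => e e0.
(* The additive errors, [C] from expansion and [K] from the envelopes, become at most [e] after
   division by [n.+1]. *)
pose n := Num.truncn (Num.max N ((C + K) / e)).
have : Num.max N ((C + K) / e) <= n.+1%:R by rewrite ltW// truncnS_gt.
rewrite ge_max => /andP[Nn]; rewrite ler_pdivrMr// => Kn.
have n0 : 0 < n.+1%:R :> R by [].
set G := `|rescale_map K g gK x - _|.
(* The loss [K] is the same in every coordinate, so it survives the supremum over [k]. *)
have : `|f (n.+1%:R *: x) - f (n.+1%:R *: z)| <= n.+1%:R * G + K.
  apply: linfty_norm_le => k.
  rewrite -lerBlDr; apply: (@le_trans _ _ `|g k (n.+1%:R *: x) - g k (n.+1%:R *: z)|).
    exact: infconv_expanding (coordK k) _ _.
  by rewrite -ler_pdivrMl//; exact: rescale_map_ge.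
move/(le_trans (fN _ Nn n0)) => H.
rewrite -(ler_pM2l n0); move: H Kn; rewrite mulrDr mulrCA; lra.
Qed.
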